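(* Neither of the functions $p\mapsto\lambda_+(p)$ and $p\mapsto\lambda_-(p)$, defined on the Wasserstein space $P_1(SL(2,\mathbb{R}))$, is continuous for the Wasserstein topology.
   Context: Norm and metric: $\|\cdot\|$ is the operator norm on $2\times 2$ real matrices induced by the Euclidean norm, and $SL(2,\mathbb{R})$ carries the metric $d(\alpha,\beta)=\|\alpha-\beta\|$. Wasserstein space: $P_1(SL(2,\mathbb{R}))$ is the set of Borel probability measures $p$ on $SL(2,\mathbb{R})$ with $\int d(\alpha,\mathrm{id})\,dp(\alpha)<\infty$. Its Wasserstein topology is the one metrized by $W_1(p,p')=\inf_{\pi}\int d(x,y)\,d\pi(x,y)$, the infimum being over all couplings $\pi$ of $p$ and $p'$ (measures on the product projecting to $p$ and $p'$). Lyapunov exponents: Let $M=SL(2,\mathbb{R})^{\mathbb{Z}}$, and for $x=(\alpha_k)_k\in M$ and $n\ge1$ let $A^n(x)=\alpha_{n-1}\cdots\alpha_0$ and $A^{-n}(x)=\alpha_{-n}^{-1}\cdots\alpha_{-1}^{-1}$. For a Borel probability measure $p$ on $SL(2,\mathbb{R})$ with $\int\log\|\alpha\|\,dp(\alpha)<\infty$ (which holds for every $p\in P_1(SL(2,\mathbb{R}))$), let $\mu=p^{\mathbb{Z}}$ be the Bernoulli measure on $M$. The limits $\lim_n\frac1n\log\|A^n(x)\|$ and $\lim_n\frac1n\log\|A^{-n}(x)\|^{-1}$ exist and are constant for $\mu$-almost every $x$ (Furstenberg--Kesten and ergodicity of the shift); these constants are the Lyapunov exponents $\lambda_+(p)$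 and $\lambda_-(p)$, respectively. *)

(* Defs.v *)
From HB Require Import structures.
From mathcomp Require Import all_boot all_order all_algebra.
From mathcomp Require Import ring.
From mathcomp Require Import all_classical all_reals all_analysis.

Set Implicit Arguments.
Unset Strict Implicit.
Unset Printing Implicit Defensive.

Import Order.TTheory GRing.Theory Num.Theory.
Import numFieldNormedType.Exports.

Local Open Scope classical_set_scope.
Local Open Scope ring_scope.

(* The norm that the library puts on matrices is the entrywise maximum, so the
   Euclidean norm and the norm it induces on operators are introduced here. *)

Section operator_norm.
Context {R : realType}.
Implicit Types (u v : 'cV[R]_2) (A B : 'M[R]_2).

Definition enorm v : R := Num.sqrt (\sum_i v i 0 ^+ 2).

Definition opnorm A : R := sup [set enorm (A *m v) | v in [set v | enorm v <= 1]].

Lemma enormE v : enorm v = Num.sqrt (v 0 0 ^+ 2 + v 1 0 ^+ 2).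
Proof.
rewrite /enorm big_ord_recl big_ord1; congr (Num.sqrt (_ + v _ _ ^+ 2)).
exact/val_inj.
Qed.

Lemma enorm_ge0 v : 0 <= enorm v.
Proof. exact: sqrtr_ge0. Qed.

Lemma enorm0 : enorm 0 = 0.
Proof. by rewrite enormE !mxE expr0n addr0 sqrtr0. Qed.

Lemma sqr_enorm v : enorm v ^+ 2 = v 0 0 ^+ 2 + v 1 0 ^+ 2.
Proof. by rewrite enormE sqr_sqrtr// addr_ge0 ?sqr_ge0. Qed.

Lemma enormN v : enorm (- v) = enorm v.
Proof. by rewrite !enormE !mxE !sqrrN. Qed.

Lemma enorm_eq0 v : enorm v = 0 -> v = 0.
Proof.
move=> v0; have /eqP := sqr_enorm v.
rewrite v0 expr0n eq_sym paddr_eq0 ?sqr_ge0// !sqrf_eq0 => /andP[/eqP a /eqP b].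
apply/matrixP => i j; rewrite (ord1 j) mxE.
case: i => [[|[|//]] hi].
  by rewrite -[RHS]a; congr (v _ _); exact/val_inj.
by rewrite -[RHS]b; congr (v _ _); exact/val_inj.
Qed.

Lemma enormD u v : enorm (u + v) <= enorm u + enorm v.
Proof.
rewrite -(@ler_pXn2r _ 2)// ?nnegrE ?addr_ge0 ?enorm_ge0//.
rewrite sqrrD !sqr_enorm !mxE.
set a := u 0 0; set b := u 1 0; set c := v 0 0; set d := v 1 0.
suff h : a * c + b * d <= enorm u * enorm v.
  rewrite -subr_ge0.
  rewrite (_ : _ - _ = (enorm u * enorm v - (a * c + b * d)) *+ 2).
    by rewrite mulrn_wge0// subr_ge0.
  by rewrite !mulr2n !expr2; ring.
apply: le_trans (ler_norm _) _.
rewrite -(@ler_pXn2r _ 2)// ?nnegrE ?normr_ge0 ?mulr_ge0 ?enorm_ge0//.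
rewrite real_normK ?num_real// exprMn !sqr_enorm -/a -/b -/c -/d -subr_ge0.
rewrite (_ : _ - _ = (a * d - b * c) ^+ 2) ?sqr_ge0// !expr2; ring.
Qed.

Lemma enorm_coord v i : `|v i 0| <= enorm v.
Proof.
rewrite -(@ler_pXn2r _ 2)// ?nnegrE ?enorm_ge0// real_normK ?num_real//.
rewrite sqr_enorm.
case: i => [[|[|//]] hi].
  rewrite (_ : Ordinal hi = 0) ?lerDl ?sqr_ge0//; exact/val_inj.
rewrite (_ : Ordinal hi = 1) ?lerDr ?sqr_ge0//; exact/val_inj.
Qed.

Lemma enorm_le_sum v : enorm v <= `|v 0 0| + `|v 1 0|.
Proof.
rewrite -(@ler_pXn2r _ 2)// ?nnegrE ?enorm_ge0// ?addr_ge0//.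
rewrite sqr_enorm sqrrD !real_normK ?num_real// lerD2r lerDl.
by rewrite mulrn_wge0// mulr_ge0.
Qed.

Let opset A := [set enorm (A *m v) | v in [set v | enorm v <= 1]].

Lemma opset_nonempty A : opset A !=set0.
Proof. by exists (enorm (A *m 0)), 0 => //=; rewrite enorm0. Qed.

Lemma opset_ubound A : has_ubound (opset A).
Proof.
exists (\sum_i \sum_j `|A i j|) => _ [v /= v1 <-].
apply: le_trans (enorm_le_sum _) _.
have -> : `|(A *m v) 0 0| + `|(A *m v) 1 0| = \sum_i `|(A *m v) i 0|.
  rewrite big_ord_recl big_ord1; congr (_ + `|(A *m v) _ _|); exact/val_inj.
apply: ler_sum => i _; rewrite mxE.
apply: le_trans (ler_norm_sum _ _ _) _; apply: ler_sum => j _.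
by rewrite normrM ler_piMr// (le_trans (enorm_coord _ _)).
Qed.

Lemma opnorm_ub A v : enorm v <= 1 -> enorm (A *m v) <= opnorm A.
Proof. by move=> v1; apply: (ub_le_sup (opset_ubound A)); exists v. Qed.

Lemma opnorm_le A c : (forall v, enorm v <= 1 -> enorm (A *m v) <= c) ->
  opnorm A <= c.
Proof.
by move=> h; apply: ge_sup; [exact: opset_nonempty|move=> _ [v ? <-]; exact: h].
Qed.

Lemma opnorm0 : opnorm 0 = 0.
Proof.
apply/eqP; rewrite eq_le; apply/andP; split.
  by apply: opnorm_le => v _; rewrite mul0mx enorm0.
by have := @opnorm_ub 0 0; rewrite mulmx0 enorm0; apply.
Qed.

Lemma opnormN A : opnorm (- A) = opnorm A.
Proof.
by congr sup; apply/seteqP; split => _ [v ? <-]; exists v;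
  rewrite // mulNmx enormN.
Qed.

Lemma opnormD A B : opnorm (A + B) <= opnorm A + opnorm B.
Proof.
apply: opnorm_le => v v1; rewrite mulmxDl (le_trans (enormD _ _))//.
by rewrite lerD// opnorm_ub.
Qed.

Lemma opnorm_eq0 A : opnorm A = 0 -> A = 0.
Proof.
move=> A0; apply/matrixP => i j; rewrite [RHS]mxE.
have e1 : enorm (delta_mx j 0) <= 1.
  rewrite enormE !mxE eqxx !andbT.
  by case: j => [[|[|//]] hj]; rewrite /= ?expr1n ?expr0n/= ?addr0 ?add0r sqrtr1.
have := opnorm_ub A e1; rewrite A0 -colE => h.
have /enorm_eq0 c0 : enorm (col j A) = 0 by apply/le_anti; rewrite h enorm_ge0.
by have /matrixP/(_ i 0) := c0; rewrite !mxE.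
Qed.

End operator_norm.

Record SL2 (R : realType) := MkSL2 {
  SL2mx :> 'M[R]_2 ;
  SL2_det : \det SL2mx == 1 }.

HB.instance Definition _ (R : realType) := [isSub for @SL2mx R].
HB.instance Definition _ (R : realType) := [Choice of SL2 R by <:].

Section SL2_structures.
Context {R : realType}.
Implicit Types a b c : SL2 R.

Fact SL2_id_det : \det (1%:M : 'M[R]_2) == 1.
Proof. by rewrite det1. Qed.

Definition SL2_id : SL2 R := MkSL2 SL2_id_det.

HB.instance Definition _ := isPointed.Build (SL2 R) SL2_id.

Definition SL2_dist a b : R := opnorm (SL2mx a - SL2mx b).

Fact SL2_distxx a : SL2_dist a a = 0.
Proof. by rewrite /SL2_dist subrr opnorm0. Qed.

Fact SL2_dist_positivity a b : SL2_dist a b = 0 -> a = b.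
Proof. by move=> /opnorm_eq0/eqP; rewrite subr_eq0 => /eqP/val_inj. Qed.

Fact SL2_dist_sym a b : SL2_dist a b = SL2_dist b a.
Proof. by rewrite /SL2_dist -opnormN opprB. Qed.

Fact SL2_dist_triangle b a c : SL2_dist a c <= SL2_dist a b + SL2_dist b c.
Proof.
apply: le_trans (opnormD _ _); rewrite addrA subrK //.
Qed.

HB.instance Definition _ := isMetric.Build R (SL2 R)
  SL2_distxx SL2_dist_positivity SL2_dist_sym SL2_dist_triangle.

HB.instance Definition _ :=
  Measurable.copy (SL2 R) (g_sigma_algebraType (@open (SL2 R))).

End SL2_structures.

Record P1 (R : realType) := MkP1 {
  P1prob :> probability (SL2 R) R ;
  P1_moment : (\int[P1prob]_a (mdist a SL2_id)%:E < +oo)%E }.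

Section wasserstein.
Context {R : realType}.
Implicit Types p q : P1 R.

Definition coupling p q : set {measure set (SL2 R * SL2 R) -> \bar R} :=
  [set m | forall B : set (SL2 R), measurable B ->
             m (fst @^-1` B) = p B /\ m (snd @^-1` B) = q B].

Definition W1 p q : \bar R :=
  ereal_inf [set (\int[m]_z (mdist z.1 z.2)%:E)%E | m in coupling p q].

HB.instance Definition _ := gen_eqMixin (P1 R).
HB.instance Definition _ := gen_choiceMixin (P1 R).

(* The metric topology of W1, given by its open sets, so that no proof of the
   triangle inequality for W1 is involved. *)
Definition W1_open : set (set (P1 R)) :=
  [set U | forall p, U p ->
     exists2 e : R, 0 < e & [set q | (W1 p q < e%:E)%E] `<=` U].

Fact W1_openT : W1_open setT.
Proof. by move=> p _; exists 1. Qed.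

Fact W1_openI : setI_closed W1_open.
Proof.
move=> U V oU oV p [/oU[e e0 eU] /oV[f f0 fV]].
exists (Num.min e f); first by rewrite lt_min e0 f0.
by move=> q /= pq; split; [apply: eU|apply: fV];
  rewrite /= (lt_le_trans pq)// lee_fin ge_min lexx ?orbT.
Qed.

Fact W1_open_bigcup (I : Type) (F : I -> set (P1 R)) :
  (forall i, W1_open (F i)) -> W1_open (\bigcup_i F i).
Proof.
move=> oF p [i _ /(oF i)[e e0 eF]]; exists e => // q /eF Fq; by exists i.
Qed.

HB.instance Definition _ :=
  isOpenTopological.Build (P1 R) W1_openT W1_openI W1_open_bigcup.

End wasserstein.

(* The sets {x | x_k \in B}, with B Borel, generate the product sigma-algebra
   of SL(2, R)^Z. *)
Definition SL2Z_generators (R : realType) : set (set (int -> SL2 R)) :=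
  [set C | exists (k : int) (B : set (SL2 R)),
             measurable B /\ C = [set x | B (x k)]].

Definition SL2Z (R : realType) := g_sigma_algebraType (@SL2Z_generators R).

Section lyapunov.
Context {R : realType}.
Implicit Types (p : probability (SL2 R) R) (x : SL2Z R) (n : nat).

(* m = p^Z: the measure of a finite-dimensional box is the product of the
   measures of its sides, which determines m. *)
Definition is_bernoulli p (m : probability (SL2Z R) R) : Prop :=
  forall (s : seq int) (B : int -> set (SL2 R)),
    uniq s -> (forall k, measurable (B k)) ->
    m [set x | forall k, k \in s -> B k (x k)] = (\prod_(k <- s) p (B k))%E.

(* A^n(x) = x_(n-1) ... x_0 *)
Fixpoint cocycle_pos n x : 'M[R]_2 :=
  if n is n'.+1 then SL2mx (x n'%:Z) *m cocycle_pos n' x else 1%:M.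

(* A^(-n)(x) = x_(-n)^-1 ... x_(-1)^-1 *)
Fixpoint cocycle_neg n x : 'M[R]_2 :=
  if n is n'.+1 then invmx (SL2mx (x (- n%:Z))) *m cocycle_neg n' x else 1%:M.

Definition is_lyapunov_plus p (l : R) : Prop :=
  exists2 m : probability (SL2Z R) R, is_bernoulli p m &
    {ae m, forall x, n%:R^-1 * ln (opnorm (cocycle_pos n x)) @[n --> \oo] --> l}.

Definition is_lyapunov_minus p (l : R) : Prop :=
  exists2 m : probability (SL2Z R) R, is_bernoulli p m &
    {ae m, forall x,
       n%:R^-1 * ln ((opnorm (cocycle_neg n x))^-1) @[n --> \oo] --> l}.

(* [get] picks the l with the stated property; for p in P_1(SL(2, R)) there is
   exactly one (Furstenberg-Kesten and ergodicity of the shift). *)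
Definition lyapunov_plus (p : P1 R) : R := get [set l | is_lyapunov_plus p l].
Definition lyapunov_minus (p : P1 R) : R := get [set l | is_lyapunov_minus p l].

End lyapunov.

(* Main.v *)
From HB Require Import structures.
Require Import Defs.
From mathcomp Require Import all_boot all_order all_algebra.
From mathcomp Require Import ring lra.
From mathcomp Require Import all_classical all_reals all_analysis.
From mathcomp Require Import measurable_realfun.

Set Implicit Arguments.
Unset Strict Implicit.
Unset Printing Implicit Defensive.

Import Order.TTheory GRing.Theory Num.Theory.
Import numFieldNormedType.Exports.
Import HBNNSimple.

Local Open Scope classical_set_scope.
Local Open Scope ring_scope.

(* Kifer's example. Let A = diag(2, 1/2), let R be the rotation by a right
   angle, and let q_e = (1 - e) delta_A + e delta_R. Moving the mass e from A
   to R costs e d(A, R), so q_e tends to q_0 = delta_A in W1; the exponents of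
   q_0 are ln 2 and - ln 2. For e > 0, since R diag(2^z, 2^-z) =
   diag(2^-z, 2^z) R, the products are diag(2^z, 2^-z) U with U an isometry,
   where z follows the random walk on the integers that goes to z + 1 with
   probability 1 - e and to - z with probability e. The mean of z stays
   bounded, so its second moment grows linearly and, by Chebyshev's inequality,
   |z_n| >= n/2 has probability O(1/n). Hence |z_n| >= n/2 almost surely does
   not hold for all large n, so lambda_+(q_e) <= ln 2 / 2 and
   lambda_-(q_e) >= - ln 2 / 2. *)

(** * Diagonal matrices, the quarter turn and their operator norms *)

Section linear_algebra.
Context {R : realType}.
Implicit Types (a b c d : R) (M U : 'M[R]_2) (v : 'cV[R]_2) (z : int).

Definition mx2 a b c d : 'M[R]_2 :=
  \matrix_(i, j) if i == 0 then (if j == 0 then a else b)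
                 else (if j == 0 then c else d).

Lemma mulmx22 n M (N : 'M[R]_(2, n)) i j :
  (M *m N) i j = M i 0 * N 0 j + M i 1 * N 1 j.
Proof.
rewrite mxE big_ord_recl big_ord1.
by congr (_ + M _ _ * N _ _); apply/val_inj.
Qed.

Lemma mx2M a b c d a' b' c' d' : mx2 a b c d *m mx2 a' b' c' d' =
  mx2 (a * a' + b * c') (a * b' + b * d') (c * a' + d * c') (c * b' + d * d').
Proof. by apply/matrixP => i j; rewrite mulmx22 !mxE /=; do 2 case: ifP. Qed.

Lemma mx2_1 : mx2 1 0 0 1 = 1%:M.
Proof. by apply/matrixP => -[[|[|//]] ?] [[|[|//]] ?]; rewrite !mxE. Qed.

Lemma det_mx2 a b c d : \det (mx2 a b c d) = a * d - b * c.
Proof.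
rewrite (expand_det_row _ 0) big_ord_recl big_ord1 /cofactor !det_mx11 !mxE /=.
by rewrite /bump /= !addn0 expr0 expr1 mul1r mulN1r mulrN.
Qed.

(** The index is an integer, so that inversion and conjugation by [rot] both become a change of
    sign. *)
Definition hyp z : 'M[R]_2 := mx2 (2 ^ z) 0 0 (2 ^ (- z)).

Definition rot : 'M[R]_2 := mx2 0 (-1) 1 0.

Lemma hyp0 : hyp 0 = 1%:M.
Proof. by rewrite /hyp oppr0 expr0z mx2_1. Qed.

Lemma hypD x y : hyp x *m hyp y = hyp (x + y).
Proof.
by rewrite /hyp mx2M !(mulr0, mul0r, addr0, add0r) opprD -!expfzDr ?pnatr_eq0.
Qed.

Lemma rot_hyp z : rot *m hyp z = hyp (- z) *m rot.
Proof. by rewrite /hyp !mx2M opprK; congr mx2; ring. Qed.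

Lemma hyp_unit z : hyp z \in unitmx.
Proof.
by have /mulmx1_unit[] : hyp z *m hyp (- z) = 1%:M by rewrite hypD subrr hyp0.
Qed.

Lemma invmx_hyp z : invmx (hyp z) = hyp (- z).
Proof.
by rewrite -[LHS]mulmx1 -hyp0 -(subrr z) -hypD mulKmx// hyp_unit.
Qed.

Lemma rot_oppr : rot *m - rot = 1%:M.
Proof.
rewrite mulmxN mx2M -mx2_1; apply/matrixP => i j; rewrite !mxE.
by do 2 case: ifP => _; ring.
Qed.

Lemma invmx_rot : invmx rot = - rot.
Proof.
by rewrite -[LHS]mulmx1 -rot_oppr mulKmx//; case/mulmx1_unit: rot_oppr.
Qed.

Lemma enorm_rot v : enorm (rot *m v) = enorm v.
Proof. by rewrite !enormE !mulmx22 !mxE /=; congr Num.sqrt; ring. Qed.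

Lemma sqr_enorm_hyp z v :
  enorm (hyp z *m v) ^+ 2 = (2 ^ z * v 0 0) ^+ 2 + (2 ^ (- z) * v 1 0) ^+ 2.
Proof.
by rewrite sqr_enorm !mulmx22 !mxE /=; congr (_ ^+ 2 + _ ^+ 2); ring.
Qed.

(** [U] maps the unit ball into itself, and both diagonal entries of [hyp z] are at most 2^|z|. *)
Lemma opnorm_hyp_isometry z U : (forall v, enorm (U *m v) = enorm v) ->
  opnorm (hyp z *m U) <= 2 ^+ `|z|%N.
Proof.
move=> isoU; apply: opnorm_le => v; rewrite -isoU -mulmxA.
move: (U *m v) => {isoU v} v v1.
apply: (@le_trans _ _ (2 ^+ `|z|%N * enorm v)); last first.
  by rewrite ler_piMr// exprn_ge0.
rewrite -(@ler_pXn2r _ 2)// ?nnegrE ?mulr_ge0 ?exprn_ge0 ?enorm_ge0//.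
rewrite exprMn sqr_enorm_hyp sqr_enorm mulrDr !exprMn.
have le2 (x : int) : `|x|%N = `|z|%N -> (2 ^ x) ^+ 2 <= (2 ^+ `|z|%N) ^+ 2 :> R.
  move=> xz; rewrite ler_pXn2r// ?nnegrE ?exprz_ge0 ?exprn_ge0//.
  rewrite -xz; change (2 ^ x <= 2 ^ `|x|%N%:Z :> R).
  by rewrite ler_weXz2l ?ler1n// abszE ler_norm.
by rewrite lerD// ler_wpM2r ?sqr_ge0// le2// abszN.
Qed.

Lemma opnorm_hyp z : opnorm (hyp z) = 2 ^+ `|z|%N.
Proof.
apply/le_anti; rewrite -{1}(mulmx1 (hyp z)) opnorm_hyp_isometry; last first.
  by move=> v; rewrite mul1mx.
have e1 (i : 'I_2) : enorm (delta_mx i 0 : 'cV[R]_2) <= 1.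
  rewrite enormE !mxE eqxx !andbT.
  by case: i => [[|[|//]] ?]; rewrite /= ?expr1n ?expr0n/= ?addr0 ?add0r sqrtr1.
(* The bound is attained at the basis vector of the larger diagonal entry. *)
have [z0|z0] := leP 0 z.
  apply: le_trans (opnorm_ub (hyp z) (e1 0)).
  rewrite -(@ler_pXn2r _ 2)// ?nnegrE ?exprn_ge0 ?enorm_ge0//.
  rewrite sqr_enorm_hyp !mxE /= mulr0 expr0n addr0 mulr1.
  by rewrite -[X in 2 ^ X](gez0_abs z0).
apply: le_trans (opnorm_ub (hyp z) (e1 1)).
rewrite -(@ler_pXn2r _ 2)// ?nnegrE ?exprn_ge0 ?enorm_ge0//.
rewrite sqr_enorm_hyp !mxE /= mulr0 expr0n add0r mulr1.
have Nz0 : 0 <= - z by rewrite oppr_ge0 ltW.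
by rewrite -[X in 2 ^ X](gez0_abs Nz0) abszN.
Qed.

Lemma det_hyp z : \det (hyp z) == 1.
Proof.
by rewrite det_mx2 mulr0 subr0 -expfzDr ?pnatr_eq0// subrr expr0z.
Qed.

Lemma det_rot : \det rot == 1.
Proof. by apply/eqP; rewrite det_mx2; ring. Qed.

End linear_algebra.

(** * Moments and tails of the random walk of heights *)

Section words.
Context {R : realType} (e : R).
Implicit Types (w : seq bool) (f g : R -> R).

(* A letter is [true] for R and [false] for A; the last letter of the product
   (its leftmost factor) comes first in a word. *)
Fixpoint words n : seq (seq bool) :=
  if n is n'.+1 then [seq b :: w | w <- words n', b <- [:: false; true]]
  else [:: [::]].

Lemma wordsS n :
  words n.+1 = [seq b :: w | w <- words n, b <- [:: false; true]].
Proof. by []. Qed.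

Lemma mem_words n w : (w \in words n) = (size w == n).
Proof.
apply/idP/eqP.
  elim: n w => [|n IHn] w; first by rewrite inE => /eqP ->.
  by move=> /allpairsP[[w' b] /= [/IHn <- _ ->]].
elim: w n => [|b w IHw] [|n]// [/IHw wn].
apply/allpairsP; exists (w, b); split => //=.
by case: b; rewrite !inE.
Qed.

Definition height_step (b : bool) (z : int) : int := if b then - z else z + 1.

Definition height w : int := foldr height_step 0 w.

Definition word_prob w : R := \prod_(b <- w) (if b then e else 1 - e).

Definition expectation n f : R :=
  \sum_(w <- words n) word_prob w * f (height w)%:~R.

Lemma expectation0 f : expectation 0 f = f 0.
Proof. by rewrite /expectation big_seq1 /word_prob big_nil mul1r. Qed.

(** The head of a word acts last on the height and is independent of the tail, so averaging over it
    applies the transition operator to [f]. *)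
Lemma expectationS n f : expectation n.+1 f =
  expectation n (fun z => (1 - e) * f (z + 1) + e * f (- z)).
Proof.
rewrite /expectation wordsS big_allpairs_dep /=; apply: eq_bigr => w _.
rewrite big_cons big_seq1 /word_prob !big_cons /= intrD intrN; ring.
Qed.

Lemma expectationD n f g :
  expectation n (fun z => f z + g z) = expectation n f + expectation n g.
Proof.
by rewrite /expectation -big_split; apply: eq_bigr => w _; rewrite mulrDr.
Qed.

Lemma expectationM n c f :
  expectation n (fun z => c * f z) = c * expectation n f.
Proof.
by rewrite /expectation mulr_sumr; apply: eq_bigr => w _; rewrite mulrCA.
Qed.

Lemma expectation1 n : expectation n (fun=> 1) = 1.
Proof.
elim: n => [|n IHn]; first by rewrite expectation0.
rewrite expectationS -[RHS]IHn.
by congr (expectation _ _); apply/funext => z; ring.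
Qed.

Lemma expectation_idS n :
  expectation n.+1 id = (1 - 2 * e) * expectation n id + (1 - e).
Proof.
rewrite expectationS.
transitivity (expectation n (fun z => (1 - 2 * e) * z + (1 - e) * 1)).
  by congr (expectation _ _); apply/funext => z; ring.
by rewrite expectationD !expectationM expectation1 mulr1.
Qed.

(** The jump from z to -z preserves the square, so only the step to z + 1 changes it, by 2 z + 1. *)
Lemma expectation_sqrS n : expectation n.+1 (fun z => z ^+ 2) =
  expectation n (fun z => z ^+ 2) + (1 - e) * (2 * expectation n id + 1).
Proof.
rewrite expectationS.
transitivity (expectation n (fun z => z ^+ 2 + (1 - e) * (2 * z + 1))).
  by congr (expectation _ _); apply/funext => z; ring.
by rewrite expectationD expectationM expectationD expectationM expectation1.
Qed.

Hypotheses (e0 : 0 < e) (e1 : e <= 1 / 2).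

Lemma word_prob_ge0 w : 0 <= word_prob w.
Proof. by apply: prodr_ge0 => b _; case: b; move: e0 e1; lra. Qed.

(** For e at most 1/2, the map x |-> (1 - 2 e) x + (1 - e) of the recursion sends the interval from
    0 to 1/e into itself. *)
Lemma expectation_id_bound n : 0 <= expectation n id <= e^-1.
Proof.
elim: n => [|n /andP[E0 E1]].
  by rewrite expectation0 lexx invr_ge0 ltW.
have ee : e * e^-1 = 1 by rewrite divff ?gt_eqF.
have c0 : 0 <= 1 - 2 * e by move: e1; lra.
have E2 := mulr_ge0 c0 E0; have E3 := ler_wpM2l c0 E1.
rewrite expectation_idS; apply/andP; split; move: e0 e1 ee E2 E3; lra.
Qed.

Lemma expectation_sqr_bound n :
  expectation n (fun z => z ^+ 2) <= n%:R * (2 * e^-1 + 1).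
Proof.
elim: n => [|n IHn]; first by rewrite expectation0 expr0n mul0r.
have /andP[E0 E1] := expectation_id_bound n.
rewrite expectation_sqrS -[n.+1%:R]natr1 [leRHS]mulrDl mul1r lerD//.
have i0 : 0 < e^-1 by rewrite invr_gt0.
apply: (@le_trans _ _ (1 * (2 * expectation n id + 1))).
  by apply: ler_wpM2r; move: e0 E0; lra.
by rewrite mul1r; lra.
Qed.

(** Chebyshev's inequality: on these words the square of the height is at least (n + 1)^2 / 4, while
    its mean is O(n). *)
Lemma high_words_prob n :
  \sum_(w <- words n.+1 | n.+1%:R <= 2 * `|(height w)%:~R : R|) word_prob w <=
  4 * (2 * e^-1 + 1) / n.+1%:R.
Proof.
set N : R := n.+1%:R; have N0 : 0 < N by rewrite ltr0n.
rewrite ler_pdivlMr// -(ler_pM2r N0).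
apply: (@le_trans _ _ (4 * expectation n.+1 (fun z => z ^+ 2))); last first.
  have := expectation_sqr_bound n.+1; rewrite -/N; lra.
rewrite -mulrA mulr_suml /expectation mulr_sumr big_mkcond /=.
apply: ler_sum => w _; have p0 := word_prob_ge0 w.
case: ifPn => [h|_]; last first.
  by do 2![apply: mulr_ge0 => //]; exact: sqr_ge0.
rewrite [leRHS]mulrCA ler_wpM2l//.
rewrite -[_ ^+ 2]real_normK ?num_real//.
set t := `|_| in h *.
have : N * N <= (2 * t) * (2 * t) by apply: ler_pM => //; exact: ltW.
lra.
Qed.

End words.

(** * Convex combinations of two Dirac measures *)

Section mixture.
Context d (T : measurableType d) (R : realType) (e : {i01 R}) (a b : T).

Definition mixture : set T -> \bar R :=
  measure_add (mscale (1 - e%:num)%:nng (dirac a))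
    (mscale e%:num%:nng (dirac b)).

HB.instance Definition _ := Measure.on mixture.

Lemma mixtureE B :
  mixture B = ((1 - e%:num) * (a \in B)%:R + e%:num * (b \in B)%:R)%:E.
Proof. by rewrite /mixture measure_addE /mscale. Qed.

Let mixture_setT : mixture setT = 1%E.
Proof. by rewrite mixtureE !in_setT !mulr1 subrK. Qed.

HB.instance Definition _ :=
  Measure_isProbability.Build _ _ _ mixture mixture_setT.

(* For a measurable [f] this is an equality; the bound needs no measurability,
   so that it applies to the distance on the product sigma-algebra. *)
Lemma integral_mixture_le (f : T -> R) : (forall x, 0 <= f x) ->
  (\int[mixture]_x (f x)%:E <= ((1 - e%:num) * f a + e%:num * f b)%:E)%E.
Proof.
(* The integral is a supremum over simple functions below [f]; these are measurable, so their
   integrals can be computed exactly. *)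
move=> f0; rewrite ge0_integralTE; last by move=> x; rewrite lee_fin.
apply: ge_ereal_sup => _ [h /= hf <-].
pose g (x : T) : \bar R := (h x)%:E.
have mh : measurable_fun setT g by apply/measurable_EFinP.
have h0 x : setT x -> (0 <= g x)%E by rewrite lee_fin.
rewrite -integralT_nnsfun ge0_integral_measure_add// !ge0_integral_mscale//.
rewrite !integral_dirac// !diracE !in_setT !mul1e -!EFinM -EFinD lee_fin.
by apply: lerD; apply: ler_wpM2l => //; rewrite -lee_fin.
Qed.

End mixture.

(** * Kifer's measures and their Wasserstein distance to the Dirac mass *)

Section kifer_example.
Context {R : realType} (e : {i01 R}).

Definition hyp1 : SL2 R := MkSL2 (det_hyp 1).
Definition quarter : SL2 R := MkSL2 (@det_rot R).

Let mixture_moment :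
  (\int[mixture e hyp1 quarter]_a (mdist a SL2_id)%:E < +oo)%E.
Proof.
apply: le_lt_trans (integral_mixture_le _ _ _ _) (ltry _) => x.
exact: mdist_ge0.
Qed.

Definition kifer : P1 R := MkP1 mixture_moment.

End kifer_example.

Lemma W1_kifer (R : realType) (e0 e : {i01 R}) : e0%:num = 0 ->
  (W1 (kifer e0) (kifer e) <= (e%:num * mdist (hyp1 : SL2 R) quarter)%:E)%E.
Proof.
(* The coupling keeps the mass 1 - e in place at [hyp1] and sends the mass e from [hyp1] to
   [quarter]. *)
move=> e00; pose m := mixture e (hyp1 : SL2 R, hyp1 : SL2 R) (hyp1, quarter).
apply: (@le_trans _ _ (\int[m]_z (mdist z.1 z.2)%:E)%E).
  apply: ereal_inf_lbound; exists m => // B mB.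
  split; rewrite /= !mixtureE//.
  by rewrite -mulrDl e00 subrK subr0 mul0r addr0.
apply: le_trans (integral_mixture_le _ _ _ _) _ => [z|].
  exact: mdist_ge0.
by rewrite /= mdistxx mulr0 add0r.
Qed.

(** * Cylinders under Bernoulli measures and almost sure growth *)

Section bernoulli_measures.
Context {R : realType}.

Lemma measurable_point (a : SL2 R) : measurable [set a].
Proof.
rewrite -[X in measurable X]setCK; apply: measurableC.
apply: sub_sigma_algebra; apply: closed_openC; apply: accessible_closed_set1.
by apply: hausdorff_accessible; exact: metric_hausdorff.
Qed.

Lemma measurable_coord k (B : set (SL2 R)) : measurable B ->
  measurable [set x : SL2Z R | B (x k)].
Proof. by move=> mB; apply: sub_sigma_algebra; exists k, B. Qed.

(** Every coordinate has law [p], and a countable union of null events is null. *)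
Lemma bernoulli_coord_negligible p (m : probability (SL2Z R) R)
    (idx : nat -> int) B :
  is_bernoulli p m -> measurable B -> p (~` B) = 0%E ->
  m.-negligible [set x : SL2Z R | exists n, ~ B (x (idx n))].
Proof.
move=> mp mB pB.
have -> : [set x : SL2Z R | exists n, ~ B (x (idx n))] =
    \bigcup_n [set x | (~` B) (x (idx n))].
  by apply/seteqP; split => x [n]; [move=> ?|move=> _ ?]; exists n.
apply: negligible_bigcup => n; apply/negligibleP.
  exact: (@measurable_coord (idx n) (~` B)) (measurableC mB).
have := mp [:: idx n] (fun=> ~` B) isT (fun=> measurableC mB).
rewrite big_seq1 pB => <-; congr (m _); apply/seteqP; split => x /=.
  by move=> h k; rewrite inE => /eqP ->.
by apply; rewrite inE.
Qed.

Definition letter (b : bool) : SL2 R := if b then quarter else hyp1.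

Lemma hyp1_neq_quarter : (hyp1 : SL2 R) <> quarter.
Proof.
move=> /(congr1 (fun a : SL2 R => SL2mx a 0 0)); rewrite /= !mxE /= => /eqP.
by apply/negP; rewrite pnatr_eq0.
Qed.

Lemma kifer_letter (e : {i01 R}) b :
  kifer e [set letter b] = (if b then e%:num else 1 - e%:num)%:E.
Proof.
have hq : hyp1 \in [set quarter : SL2 R] = false.
  by apply/negP; rewrite inE; exact: hyp1_neq_quarter.
have qh : quarter \in [set hyp1 : SL2 R] = false.
  by apply/negP; rewrite inE => /esym; exact: hyp1_neq_quarter.
have self (a : SL2 R) : a \in [set a] by rewrite inE.
rewrite /= mixtureE; case: b => /=.
  by rewrite hq self mulr0 add0r mulr1.
by rewrite qh self mulr0 addr0 mulr1.
Qed.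

Lemma kifer_letters (e : {i01 R}) : kifer e (~` range letter) = 0%E.
Proof.
have nl b : (letter b \in ~` range letter) = false.
  by apply/negP; rewrite inE; apply; exists b.
by rewrite /= mixtureE (nl false) (nl true) !mulr0 addr0.
Qed.

Lemma measurable_letters : measurable (range letter).
Proof.
rewrite (_ : range letter = [set letter true] `|` [set letter false]).
  by apply: measurableU; exact: measurable_point.
apply/seteqP; split => [_ [[] _ <-]|a [->|->]]; by [left|right|eexists].
Qed.

Section cylinders.
(* [idx n] is the coordinate read at time n: [n] for [cocycle_pos] and
   [- (n + 1)] for [cocycle_neg]. *)
Variable idx : nat -> int.
Hypothesis idx_inj : injective idx.

Fixpoint cylinder (w : seq bool) : set (SL2Z R) :=
  if w is b :: w' then [set x | x (idx (size w')) = letter b] `&` cylinder w'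
  else setT.

Lemma measurable_cylinder w : measurable (cylinder w).
Proof.
elim: w => [|b w IHw] //=; apply: measurableI => //.
exact: (@measurable_coord _ [set letter b]) (measurable_point _).
Qed.

(** Together with [indices], this presents a cylinder as a box, the form on which [is_bernoulli]
    evaluates the measure. *)
Fixpoint sides (w : seq bool) : int -> set (SL2 R) :=
  if w is b :: w' then
    fun k => if k == idx (size w') then [set letter b] else sides w' k
  else fun=> setT.

Fixpoint indices (w : seq bool) : seq int :=
  if w is b :: w' then idx (size w') :: indices w' else [::].

Lemma mem_indices w n : (idx n \in indices w) = (n < size w)%N.
Proof.
elim: w => [|b w IHw] //=.
by rewrite inE IHw (inj_eq idx_inj) ltnS [RHS]leq_eqVlt.
Qed.

Lemma indices_neq w k : k \in indices w -> k != idx (size w).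
Proof. by apply: contraL => /eqP ->; rewrite mem_indices ltnn. Qed.

Lemma uniq_indices w : uniq (indices w).
Proof. by elim: w => [|b w IHw] //=; rewrite mem_indices ltnn. Qed.

(** Injectivity of [idx] keeps the coordinate of the newest letter out of the earlier indices, so
    the override in [sides] leaves the earlier constraints intact. *)
Lemma cylinderE w :
  cylinder w = [set x | forall k, k \in indices w -> sides w k (x k)].
Proof.
elim: w => [|b w IHw] /=; first by apply/seteqP; split.
rewrite IHw; apply/seteqP; split => x /=.
  move=> [xb xw] k; rewrite inE => /orP[/eqP ->|ks]; first by rewrite eqxx.
  by rewrite (negPf (indices_neq ks)); exact: xw.
move=> h; split; first by have := h _ (mem_head _ _); rewrite eqxx.
move=> k ks; have := h k; rewrite (negPf (indices_neq ks)); apply.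
by rewrite inE ks orbT.
Qed.

Lemma cylinder_prob (e : {i01 R}) (m : probability (SL2Z R) R) w :
  is_bernoulli (kifer e) m -> m (cylinder w) = (word_prob e%:num w)%:E.
Proof.
move=> mp; rewrite cylinderE mp ?uniq_indices//; last first.
  elim: w => [|b w IHw] k //=; case: ifP => _; last exact: IHw.
  exact: measurable_point.
elim: w => [|b w IHw] /=; first by rewrite big_nil /word_prob big_nil.
rewrite big_cons eqxx kifer_letter /word_prob big_cons EFinM; congr (_ * _)%E.
rewrite -[RHS]IHw big_seq [RHS]big_seq; apply: eq_bigr => k ks.
by rewrite (negPf (indices_neq ks)).
Qed.

Lemma cylinder_cover (x : SL2Z R) n : (forall k, range letter (x (idx k))) ->
  exists2 w, size w = n & cylinder w x.
Proof.
move=> xl; elim: n => [|n [w wn wx]]; first by exists [::].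
by have [b _ bx] := xl n; exists (b :: w) => /=; rewrite wn.
Qed.

End cylinders.

Lemma measure_bigsetU_le d (T : measurableType d)
    (m : {measure set T -> \bar R}) (I : Type) (s : seq I) (P : pred I)
    (F : I -> set T) :
  (forall i, measurable (F i)) ->
  (m (\big[setU/set0]_(i <- s | P i) F i) <= \sum_(i <- s | P i) m (F i))%E.
Proof.
move=> mF; elim: s => [|i s IHs]; first by rewrite !big_nil measure0.
rewrite !big_cons; case: ifP => // _.
apply: le_trans (measureU2 _ _ _) _ => //; first exact: bigsetU_measurable.
exact: leeD2l.
Qed.

Lemma probability_setT_negligible d (T : measurableType d)
    (m : probability T R) : ~ m.-negligible setT.
Proof.
move=> /(measure_negligible measurableT) m0.
have := probability_setT m; rewrite m0 => /eqP.
by rewrite eqe eq_sym oner_eq0.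
Qed.

(** If l > c / 2, almost every point has |height| > n / 2 for all large n, although at each single
    time n this has probability O(1/n). Keeping [g] and [c] general serves both exponents. *)
Lemma kifer_growth (e : {i01 R}) (m : probability (SL2Z R) R)
    (idx : nat -> int) (g : nat -> SL2Z R -> R) (c l : R) :
  0 < e%:num -> e%:num <= 1 / 2 -> is_bernoulli (kifer e) m ->
  injective idx -> 0 < c ->
  (forall w x, cylinder idx w x -> g (size w) x <= `|height w|%N%:R * c) ->
  {ae m, forall x, n%:R^-1 * g n x @[n --> \oo] --> l} -> l <= c / 2.
Proof.
move=> e0 e1 mp idx_inj c0 gw aecvg; rewrite leNgt; apply/negP => cl.
pose P n w := n.+1%:R <= 2 * `|(height w)%:~R : R|.
(* [H n] concerns words of length n + 1, so that the denominators below are nonzero. *)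
pose H n := \big[setU/set0]_(w <- words n.+1 | P n w) cylinder idx w.
pose C : R := 4 * (2 * (e%:num)^-1 + 1).
have C0 : 0 <= C by rewrite mulr_ge0// addr_ge0// mulr_ge0// invr_ge0 ltW.
have mH n : measurable (H n).
  by apply: bigsetU_measurable => w _; exact: measurable_cylinder.
have HC n : (m (H n) <= (C / n.+1%:R)%:E)%E.
  apply: le_trans (measure_bigsetU_le _ _ _ _) _ => [w|].
    exact: measurable_cylinder.
  rewrite (eq_bigr (fun w => (word_prob e%:num w)%:E)); last first.
    by move=> w _; exact: cylinder_prob.
  by rewrite sumEFin lee_fin; exact: high_words_prob.
pose K N := \bigcap_(n in [set n | (N <= n)%N]) H n.
have mK N : measurable (K N) by apply: bigcap_measurable => //; exists N => /=.
have K0 N : m.-negligible (K N).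
  apply/negligibleP => //; suff: (m (K N) <= 0)%E.
    by move=> K0; apply/le_anti; rewrite measure_ge0 andbT.
  have finK : m (K N) \is a fin_num by exact: fin_num_measure.
  rewrite -(fineK finK) lee_fin leNgt; apply/negP => r0.
  set r := fine _ in r0.
  (* n >= N places [K N] inside [H n], and n + 1 > C / r makes the bound on the measure of [H n]
     smaller than [r]. *)
  pose n := maxn N (Num.bound (C / r)).
  have : (m (K N) <= (C / n.+1%:R)%:E)%E.
    apply: le_trans (HC n); apply: le_measure; rewrite ?inE//.
    by apply: bigcap_inf => /=; exact: leq_maxl.
  rewrite -(fineK finK) lee_fin -/r leNgt => /negP; apply.
  rewrite ltr_pdivrMr// mulrC -ltr_pdivrMr//.
  apply: lt_le_trans (archi_boundP _) _; first by rewrite divr_ge0// ltW.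
  by rewrite ler_nat (leq_trans (leq_maxr N _)).
apply: (@probability_setT_negligible _ _ m).
have stray :=
  bernoulli_coord_negligible idx mp measurable_letters (kifer_letters e).
(* Three null sets would cover the space: no convergence, a letter other than [hyp1] and [quarter],
   large heights from some time on. *)
have null := negligibleU (negligibleU aecvg stray) (negligible_bigcup K0).
apply: negligibleS null => x _.
have [cvgx|?] := pselect (n%:R^-1 * g n x @[n --> \oo] --> l);
  last by left; left.
have [|xs] := pselect (exists n, ~ range letter (x (idx n))).
  by left; right.
right; have [N _ gtN] := cvgr_gt _ cvgx _ cl.
exists N => // n /= Nn.
have xl k : range letter (x (idx k)).
  by apply: contrapT => ?; apply: xs; exists k.
have [w wn wx] := cylinder_cover n.+1 xl.
rewrite /H -bigcup_seq_cond; exists w => //.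
apply/andP; split; first by rewrite mem_words wn.
have := gtN n.+1 (leqW Nn); have := gw _ _ wx; rewrite wn => gle.
rewrite ltr_pdivlMl// => /lt_le_trans/(_ gle).
rewrite mulrA ltr_pdivrMr// mulrAC ltr_pM2r// => h.
by rewrite /P -intr_norm -natr_absz mulrC ltW.
Qed.

End bernoulli_measures.

(** * Lyapunov exponents of Kifer's measures and the discontinuity *)

Section exponents.
Context {R : realType}.
Implicit Types (e : {i01 R}) (m : probability (SL2Z R) R) (l : R).

Let ln2_gt0 : 0 < ln 2 :> R.
Proof. by rewrite ln_gt0// ltr1n. Qed.

Lemma ln_opnorm_le z (U : 'M[R]_2) : (forall v, enorm (U *m v) = enorm v) ->
  ln (opnorm (hyp z *m U)) <= `|z|%N%:R * ln 2.
Proof.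
(* [ln] takes the value 0 at nonpositive arguments, and the bound is nonnegative. *)
move=> isoU; have [M0|M0] := leP (opnorm (hyp z *m U)) 0.
  by rewrite ln0// mulr_ge0// ltW.
rewrite mulr_natl -lnXn//; rewrite ler_ln ?posrE ?exprn_gt0//.
exact: opnorm_hyp_isometry.
Qed.

Lemma ln_opnorm_hyp z : ln (opnorm (hyp z : 'M[R]_2)) = `|z|%N%:R * ln 2.
Proof. by rewrite opnorm_hyp lnXn// mulr_natl. Qed.

Lemma lnV_le (x y : R) : 0 <= y -> ln x <= y -> - ln x^-1 <= y.
Proof.
move=> y0; have [x0|x0] := leP x 0.
  by rewrite [ln x^-1]ln0 ?oppr0// invr_le0.
by rewrite lnV ?posrE// opprK.
Qed.

Lemma cocycle_pos_cylinder w (x : SL2Z R) : cylinder Posz w x ->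
  exists2 U : 'M[R]_2, forall v, enorm (U *m v) = enorm v &
    cocycle_pos (size w) x = hyp (height w) *m U.
Proof.
elim: w => [|b w IHw] /=.
  by exists 1%:M => [v|]; rewrite ?mul1mx// hyp0 mulmx1.
move=> [-> /IHw[U isoU ->]]; case: b => /=.
  exists (rot *m U) => [v|]; first by rewrite -mulmxA enorm_rot.
  by rewrite !mulmxA rot_hyp.
by exists U => //; rewrite mulmxA hypD addrC.
Qed.

(** The inverse letters are [hyp (-1)] and [- rot], so the exponent follows the same walk with the
    opposite sign. *)
Lemma cocycle_neg_cylinder w (x : SL2Z R) :
  cylinder (fun n => - n.+1%:Z) w x ->
  exists2 U : 'M[R]_2, forall v, enorm (U *m v) = enorm v &
    cocycle_neg (size w) x = hyp (- height w) *m U.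
Proof.
elim: w => [|b w IHw] /=.
  by exists 1%:M => [v|]; rewrite ?mul1mx// oppr0 hyp0 mulmx1.
move=> [-> /IHw[U isoU ->]]; case: b => /=.
  exists (- rot *m U) => [v|]; first by rewrite -mulmxA mulNmx enormN enorm_rot.
  by rewrite invmx_rot !mulNmx mulmxN !mulmxA rot_hyp.
by exists U => //; rewrite invmx_hyp mulmxA hypD opprD addrC.
Qed.

Lemma kifer_plus_le e l : 0 < e%:num -> e%:num <= 1 / 2 ->
  is_lyapunov_plus (kifer e) l -> l <= ln 2 / 2.
Proof.
move=> e0 e1 [m mp]; apply: (kifer_growth e0 e1 mp (idx := Posz)) => //.
  by move=> i j [].
move=> w x /cocycle_pos_cylinder[U isoU ->]; exact: ln_opnorm_le.
Qed.

Lemma kifer_minus_ge e l : 0 < e%:num -> e%:num <= 1 / 2 ->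
  is_lyapunov_minus (kifer e) l -> - (ln 2 / 2) <= l.
Proof.
move=> e0 e1 [m mp cvgl]; rewrite lerNl.
apply: (kifer_growth e0 e1 mp (idx := fun n => - n.+1%:Z)
  (g := fun n x => - ln (opnorm (cocycle_neg n x))^-1)) => //.
- by move=> i j /oppr_inj[].
- move=> w x /cocycle_neg_cylinder[U isoU ->]; apply: lnV_le.
    by rewrite mulr_ge0// ltW.
  by rewrite -abszN; exact: ln_opnorm_le.
- apply: filterS cvgl => x /cvgN; apply: cvg_trans.
  by apply: near_eq_cvg; apply: nearW => n; rewrite /= mulrN.
Qed.

Definition hyp1_path : SL2Z R := fun=> hyp1.

(** Both sides of the product formula are 1 if every [B k] with k in [s] contains [hyp1], and 0
    otherwise. Exhibiting this measure shows that the exponents at e = 0 exist, so [get] does not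
    fall back on its default there. *)
Lemma dirac_bernoulli e : e%:num = 0 ->
  is_bernoulli (kifer e) (\d_hyp1_path : probability (SL2Z R) R).
Proof.
move=> e0 s B _ _.
pose box (s : seq int) := [set x : SL2Z R | forall k, k \in s -> B k (x k)].
rewrite -/(box s) /= diracE; elim: s => [|k s IHs].
  by rewrite big_nil mem_set.
rewrite big_cons -IHs /= mixtureE e0 subr0 mul1r mul0r addr0.
rewrite -EFinM -natrM mulnb.
congr (_%:R%:E); congr nat_of_bool; apply/idP/andP.
  rewrite !inE => h; split; first by apply: (h k); rewrite mem_head.
  by move=> j js; apply: h; rewrite inE js orbT.
rewrite !inE => -[hk h] j; rewrite inE => /predU1P[->|]; first exact: hk.
exact: h.
Qed.

Lemma constant_ae e m (idx : nat -> int) :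
  e%:num = 0 -> is_bernoulli (kifer e) m ->
  {ae m, forall x, forall n, x (idx n) = hyp1}.
Proof.
move=> e0 mp.
have h : kifer e (~` [set hyp1]) = 0%E.
  have hh : hyp1 \in ~` [set hyp1 : SL2 R] = false.
    by apply/negP; rewrite inE; apply.
  by rewrite /= mixtureE e0 mul0r hh mulr0 addr0.
have null := bernoulli_coord_negligible idx mp (@measurable_point R hyp1) h.
by apply: negligibleS null => x /existsNP.
Qed.

Lemma constant_pos_ae e m : e%:num = 0 -> is_bernoulli (kifer e) m ->
  {ae m, forall x,
     n%:R^-1 * ln (opnorm (cocycle_pos n x)) @[n --> \oo] --> (ln 2 : R)}.
Proof.
move=> e0 mp; apply: negligibleS (constant_ae Posz e0 mp) => x.
apply: contra_not => xh.
have xE n : cocycle_pos n x = hyp n%:Z.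
  by elim: n => [|n IHn] /=; rewrite ?hyp0// xh IHn hypD -PoszD add1n.
apply: (@cvg_trans _ ((ln 2 : R) @[n --> \oo])); last exact: cvg_cst.
(* At n = 0 the quotient is 0, so the sequence equals ln 2 only from n = 1 on. *)
apply: near_eq_cvg; near=> n; rewrite xE ln_opnorm_hyp absz_nat mulKf//.
by rewrite pnatr_eq0 -lt0n; near: n; exists 1%N.
Unshelve. all: by end_near. Qed.

Lemma constant_neg_ae e m : e%:num = 0 -> is_bernoulli (kifer e) m ->
  {ae m, forall x,
     n%:R^-1 * ln ((opnorm (cocycle_neg n x))^-1) @[n --> \oo] -->
     (- ln 2 : R)}.
Proof.
move=> e0 mp; apply: negligibleS (constant_ae (fun n => - n.+1%:Z) e0 mp) => x.
apply: contra_not => xh.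
have xE n : cocycle_neg n x = hyp (- n%:Z).
  elim: n => [|n IHn] /=; rewrite ?hyp0// xh IHn invmx_hyp hypD.
  by rewrite -opprD -PoszD add1n.
apply: (@cvg_trans _ ((- ln 2 : R) @[n --> \oo])); last exact: cvg_cst.
apply: near_eq_cvg; near=> n.
rewrite xE lnV ?posrE ?opnorm_hyp ?exprn_gt0// -opnorm_hyp ln_opnorm_hyp.
rewrite abszN absz_nat mulrN mulKf//.
by rewrite pnatr_eq0 -lt0n; near: n; exists 1%N.
Unshelve. all: by end_near. Qed.

Lemma ae_cvg_unique m (f : nat -> SL2Z R -> R) l l' :
  {ae m, forall x, f n x @[n --> \oo] --> l} ->
  {ae m, forall x, f n x @[n --> \oo] --> l'} -> l = l'.
Proof.
move=> fl fl'; apply: contrapT => ll'.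
apply: (@probability_setT_negligible _ _ _ m).
apply: negligibleS (negligibleU fl fl') => x _.
apply: contrapT => /not_orP[/contrapT xl /contrapT xl']; apply: ll'.
exact: cvg_unique xl xl'.
Qed.

(** The measure that accompanies the value chosen by [get] is only known to be Bernoulli, and this
    suffices for the almost sure limit ln 2. *)
Lemma kifer0_plus e : e%:num = 0 -> lyapunov_plus (kifer e) = ln 2.
Proof.
move=> e0; have /getI[m mp ml] : is_lyapunov_plus (kifer e) (ln 2).
  exists (\d_hyp1_path : probability (SL2Z R) R); first exact: dirac_bernoulli.
  exact: constant_pos_ae (dirac_bernoulli e0).
exact: ae_cvg_unique ml (constant_pos_ae e0 mp).
Qed.

Lemma kifer0_minus e : e%:num = 0 -> lyapunov_minus (kifer e) = - ln 2.
Proof.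
move=> e0; have /getI[m mp ml] : is_lyapunov_minus (kifer e) (- ln 2).
  exists (\d_hyp1_path : probability (SL2Z R) R); first exact: dirac_bernoulli.
  exact: constant_neg_ae (dirac_bernoulli e0).
exact: ae_cvg_unique ml (constant_neg_ae e0 mp).
Qed.

(* If [q_e] had no exponent, [get] would return the default value [0], which
   satisfies the bound as well: for e > 0 neither the existence of [q_e^Z] nor
   that of the limit is needed. *)
Lemma lyapunov_plus_kifer_le e : 0 < e%:num -> e%:num <= 1 / 2 ->
  lyapunov_plus (kifer e) <= ln 2 / 2.
Proof.
move=> e0 e1.
have [[l hl]|no] := pselect (exists l, is_lyapunov_plus (kifer e) l).
  exact: kifer_plus_le e0 e1 (getI hl).
rewrite /lyapunov_plus getPN; first by rewrite divr_ge0// ltW.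
by move=> l hl; apply: no; exists l.
Qed.

Lemma lyapunov_minus_kifer_ge e : 0 < e%:num -> e%:num <= 1 / 2 ->
  - (ln 2 / 2) <= lyapunov_minus (kifer e).
Proof.
move=> e0 e1.
have [[l hl]|no] := pselect (exists l, is_lyapunov_minus (kifer e) l).
  exact: kifer_minus_ge e0 e1 (getI hl).
rewrite /lyapunov_minus getPN; first by rewrite oppr_le0 divr_ge0// ltW.
by move=> l hl; apply: no; exists l.
Qed.

(** Continuity would force f > c / 2 on a [W1]-ball around the Dirac mass, and this ball contains
    [kifer e] for small e. A sign change makes the lemma apply to [lyapunov_minus] too. *)
Lemma kifer_discontinuity (f : P1 R -> R) (c : R) : 0 < c ->
  (forall e, e%:num = 0 -> f (kifer e) = c) ->
  (forall e, 0 < e%:num -> e%:num <= 1 / 2 -> f (kifer e) <= c / 2) ->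
  ~ continuous f.
Proof.
move=> c0 f0 fe cf.
have z01 : (0 : R) <= 1 by [].
pose e0 := Itv01 (lexx 0) z01.
have c2 : c / 2 < f (kifer e0) by rewrite (f0 e0 erefl); move: c0; lra.
have : nbhs (kifer e0) [set p | c / 2 < f p].
  exact: (cvgr_gt _ (cf (kifer e0)) _ c2).
rewrite nbhsE; case=> V [oV Ve0] Vf.
have [r r0 rV] := oV _ Ve0.
pose D := mdist (hyp1 : SL2 R) quarter.
have D0 : 0 <= D by exact: mdist_ge0.
have D1 : 0 < 2 * (D + 1) by rewrite mulr_gt0// ltr_wpDl.
(* The term 1/2 meets the bound required of e, and the other one gives t D < r; adding 1 to [D]
   keeps the denominator positive. *)
pose t : R := Num.min (1 / 2) (r / (2 * (D + 1))).
have t0 : 0 < t by rewrite lt_min !divr_gt0.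
have t2 : t <= 1 / 2 by rewrite ge_min lexx.
have t1 : t <= 1 by apply: le_trans t2 _; rewrite ler_pdivrMr// mul1r ler1n.
pose e := Itv01 (ltW t0) t1.
have : V (kifer e).
  apply: rV => /=; apply: le_lt_trans (@W1_kifer R e0 e erefl) _.
  rewrite lte_fin /=.
  apply: (@le_lt_trans _ _ (r / (2 * (D + 1)) * D)).
    by apply: ler_wpM2r => //; rewrite ge_min lexx orbT.
  rewrite mulrAC ltr_pdivrMr// ltr_pM2l//; move: D0; lra.
move=> /Vf /=; apply/negP; rewrite -leNgt; exact: fe.
Qed.

End exponents.

Theorem theorem1p2 (R : realType) :
  ~ continuous (@lyapunov_plus R) /\ ~ continuous (@lyapunov_minus R).
Proof.
have ln2 : 0 < ln 2 :> R by rewrite ln_gt0// ltr1n.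
split.
  apply: (kifer_discontinuity ln2) => e; first exact: kifer0_plus.
  exact: lyapunov_plus_kifer_le.
move=> cl; apply: (@kifer_discontinuity R (fun p => - lyapunov_minus p) _ ln2).
- by move=> e /kifer0_minus ->; rewrite opprK.
- by move=> e e0 e1; rewrite lerNl; exact: lyapunov_minus_kifer_ge.
- by move=> p; exact: (cvgN (cl p)).
Qed.
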